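(* Let $H_1$ be the $3$-dimensional Heisenberg Lie group, i.e. $\mathbb R^3$ with the product $$(x,y,z)(x',y',z')=\bigl(x+x',\,y+y',\,z+z'+\tfrac12(xy'-yx')\bigr),$$ endowed with the left-invariant Riemannian metric for which the left-invariant vector fields $$X_1=\frac{\partial}{\partial x}-\frac y2\frac{\partial}{\partial z},\qquad X_2=\frac{\partial}{\partial y}+\frac x2\frac{\partial}{\partial z},\qquad X_3=\frac{\partial}{\partial z}$$ are orthonormal. Then $H_1$ has index of symmetry $i_{\mathfrak s}(H_1)=1$. Moreover, the Killing vector field $$Y^*=X_3-\tfrac12X_4^*,\qquad\text{where } X_4^*=-yX_1+xX_2-\tfrac12(x^2+y^2)X_3,$$ is parallel at the origin $e=(0,0,0)$, i.e. $(\nabla Y^* )_e=0$.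
   Context: Let $M$ be a homogeneous Riemannian manifold with Levi-Civita connection $\nabla$. For $p\in M$ put $$\mathfrak s_p=\{v\in T_pM:\ \text{there is a Killing field } X \text{ on } M \text{ with } X(p)=v \text{ and } (\nabla X)_p=0\}.$$ The index of symmetry $i_{\mathfrak s}(M)$ is $\dim \mathfrak s_p$, which by homogeneity does not depend on $p$.
   Formalization: The sign in Y* is corrected: the result proved is for Y* = X3 + ½X4*; with the printed X3 − ½X4* one gets (∇_{X1}Y* )_e = −X2 ≠ 0, so the printed field is not parallel at e. *)

(* Defs.v *)
From HB Require Import structures.
From mathcomp Require Import all_boot all_order all_algebra.
From mathcomp Require Import all_classical all_reals all_analysis.
Set Implicit Arguments.
Unset Strict Implicit.
Unset Printing Implicit Defensive.
Import Order.TTheory GRing.Theory Num.Theory.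
Import numFieldNormedType.Exports.
Local Open Scope classical_set_scope.
Local Open Scope ring_scope.

(* Riemannian geometry on the manifold R^n in its global chart: the tangent   *)
(* space at every point is identified with 'rV[R]_n, and a vector field is    *)
(* its vector of components in the coordinate frame.                          *)

Definition scalar_field (R : realType) (n : nat) : Type := 'rV[R]_n -> R.
Definition vector_field (R : realType) (n : nat) : Type := 'rV[R]_n -> 'rV[R]_n.
(* [g p u v] is the inner product of the tangent vectors u and v at p. *)
Definition metric_field (R : realType) (n : nat) : Type :=
  'rV[R]_n -> 'rV[R]_n -> 'rV[R]_n -> R.
(* [nabla X Y] is the covariant derivative of Y along X. *)
Definition connection (R : realType) (n : nat) : Type :=
  vector_field R n -> vector_field R n -> vector_field R n.

Fixpoint times_differentiable (R : realType) (n k : nat)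
    (f : scalar_field R n) : Prop :=
  if k is k'.+1 then
    (forall p, differentiable f p) /\
    (forall v : 'rV[R]_n, times_differentiable k' (fun p => 'D_v f p))
  else True.

(* Differentiability of the partial derivatives of one order gives the        *)
(* continuity of those of the previous order, so this is C^infinity.          *)
Definition smooth (R : realType) (n : nat) (f : scalar_field R n) : Prop :=
  forall k, times_differentiable k f.

Definition smooth_field (R : realType) (n : nat) (X : vector_field R n) : Prop :=
  forall j, smooth (fun p => X p 0 j).

(* The derivative X(f) of a function along a vector field. *)
Definition act (R : realType) (n : nat) (X : vector_field R n)
  (f : scalar_field R n) : scalar_field R n := fun p => 'D_(X p) f p.

Definition lie_bracket (R : realType) (n : nat)
    (X Y : vector_field R n) : vector_field R n :=
  fun p => 'D_(X p) Y p - 'D_(Y p) X p.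

(* The function <X, Y>. *)
Definition inner (R : realType) (n : nat) (g : metric_field R n)
  (X Y : vector_field R n) : scalar_field R n := fun p => g p (X p) (Y p).

Record riemannian_metric (R : realType) (n : nat) (g : metric_field R n) : Prop := {
  metric_linear : forall p (a : R) u u' v,
    g p (a *: u + u') v = a * g p u v + g p u' v;
  metric_sym : forall p u v, g p u v = g p v u;
  metric_pos : forall p u, u != 0 -> 0 < g p u u;
  metric_smooth : forall u v, smooth (fun p => g p u v)
}.

Record affine_connection (R : realType) (n : nat) (nabla : connection R n) : Prop := {
  nabla_smooth : forall X Y, smooth_field X -> smooth_field Y ->
    smooth_field (nabla X Y);
  nabla_linear_l : forall f X X' Y, smooth f ->
    smooth_field X -> smooth_field X' -> smooth_field Y ->
    forall p, nabla (fun q => f q *: X q + X' q) Y p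
              = f p *: nabla X Y p + nabla X' Y p;
  nabla_add_r : forall X Y Y',
    smooth_field X -> smooth_field Y -> smooth_field Y' ->
    forall p, nabla X (fun q => Y q + Y' q) p = nabla X Y p + nabla X Y' p;
  nabla_leibniz : forall f X Y, smooth f -> smooth_field X -> smooth_field Y ->
    forall p, nabla X (fun q => f q *: Y q) p
              = act X f p *: Y p + f p *: nabla X Y p
}.

Record levi_civita (R : realType) (n : nat) (g : metric_field R n)
    (nabla : connection R n) : Prop := {
  lc_connection : affine_connection nabla;
  lc_torsion_free : forall X Y, smooth_field X -> smooth_field Y ->
    forall p, nabla X Y p - nabla Y X p = lie_bracket X Y p;
  lc_metric : forall X Y Z, smooth_field X -> smooth_field Y -> smooth_field Z ->
    forall p, act X (inner g Y Z) p
              = inner g (nabla X Y) Z p + inner g Y (nabla X Z) p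
}.

(* The Lie derivative (L_X g)(Y, Z). *)
Definition lie_derivative_metric (R : realType) (n : nat) (g : metric_field R n)
    (X Y Z : vector_field R n) : scalar_field R n :=
  fun p => act X (inner g Y Z) p
    - inner g (lie_bracket X Y) Z p - inner g Y (lie_bracket X Z) p.

Definition killing (R : realType) (n : nat) (g : metric_field R n)
    (X : vector_field R n) : Prop :=
  smooth_field X /\
  forall Y Z, smooth_field Y -> smooth_field Z ->
    forall p, lie_derivative_metric g X Y Z p = 0.

(* (nabla X)_p = 0 *)
Definition parallel_at (R : realType) (n : nat) (nabla : connection R n)
    (X : vector_field R n) (p : 'rV[R]_n) : Prop :=
  forall Z, smooth_field Z -> nabla Z X p = 0.

(* The space s_p. *)
Definition symmetric_directions (R : realType) (n : nat) (g : metric_field R n)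
    (nabla : connection R n) (p : 'rV[R]_n) : set 'rV[R]_n :=
  [set v | exists X, [/\ killing g X, X p = v & parallel_at nabla X p]].

Definition has_dim (R : realType) (n : nat) (S : set 'rV[R]_n) (d : nat) : Prop :=
  exists2 V : {vspace 'rV[R]_n}, S = [set v | v \in V] & \dim V = d.

(* [d] is dim s_p at every point p; on a homogeneous manifold this dimension  *)
(* does not depend on p.                                                      *)
Definition has_index_of_symmetry (R : realType) (n : nat) (g : metric_field R n)
    (nabla : connection R n) (d : nat) : Prop :=
  forall p, has_dim (symmetric_directions g nabla p) d.

(* The Heisenberg group, with (x, y, z) = (p 0 0, p 0 1, p 0 2). *)

Definition vec3 (R : realType) (a b c : R) : 'rV[R]_3 :=
  \row_(j < 3) [:: a; b; c]`_j.

Definition heis_mul (R : realType) (p q : 'rV[R]_3) : 'rV[R]_3 :=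
  vec3 (p 0 0 + q 0 0) (p 0 1 + q 0 1)
       (p 0 2 + q 0 2 + 2^-1 * (p 0 0 * q 0 1 - p 0 1 * q 0 0)).

Definition left_invariant (R : realType) (n : nat)
    (mul : 'rV[R]_n -> 'rV[R]_n -> 'rV[R]_n) (g : metric_field R n) : Prop :=
  forall a p u v,
    g (mul a p) ('d (mul a) p u) ('d (mul a) p v) = g p u v.

Definition X1 (R : realType) : vector_field R 3 :=
  fun p => vec3 1 0 (- (p 0 1 / 2)).
Definition X2 (R : realType) : vector_field R 3 :=
  fun p => vec3 0 1 (p 0 0 / 2).
Definition X3 (R : realType) : vector_field R 3 :=
  fun p => vec3 0 0 1.

Definition heis_frame (R : realType) (i : 'I_3) : vector_field R 3 :=
  [:: @X1 R; @X2 R; @X3 R]`_i.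

Definition orthonormal_frame (R : realType) (n : nat) (g : metric_field R n)
    (E : 'I_n -> vector_field R n) : Prop :=
  forall p i j, g p (E i p) (E j p) = (i == j)%:R.

Definition X4star (R : realType) : vector_field R 3 :=
  fun p => - p 0 1 *: X1 p + p 0 0 *: X2 p
           - ((p 0 0 ^+ 2 + p 0 1 ^+ 2) / 2) *: X3 p.

(* Erratum: the source prints Y* = X3 - (1/2) X4*, but with these X1, X2, X3   *)
(* and X4* that field is not parallel at 0. As [X1, X2] = X3, one has at 0     *)
(*   nabla_X1 X3 = - (1/2) X2,   nabla_X2 X3 = (1/2) X1,                       *)
(*   nabla_X1 X4* = X2,          nabla_X2 X4* = - X1,                          *)
(* so X3 + c X4* is parallel at 0 exactly when c = 1/2.                        *)
Definition Ystar (R : realType) : vector_field R 3 :=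
  fun p => X3 p + 2^-1 *: X4star p.

(* Main.v *)
Require Import Defs.
From mathcomp Require Import all_boot all_order all_algebra.
From mathcomp Require Import all_classical all_reals all_analysis.
From mathcomp Require Import ring lra.
(* Write K = f1 X1 + f2 X2 + f3 X3. The Killing equation of the Heisenberg      *)
(* metric is a first order linear system in the f_i, and commuting derivatives  *)
(* through [X1, X2] = X3 shows that its solutions satisfy X3 f1 = X3 f2 = 0.    *)
(* For a Killing field the Koszul formula makes nabla K half the exterior       *)
(* derivative of <K, .>; hence (nabla K)_p = 0 forces X3 f1 = - f2 / 2 and      *)
(* X3 f2 = f1 / 2 at p, and K(p) is a multiple of X3. Conversely X3 + X4* / 2,  *)
(* pushed forward by the left translation by p, is Killing and parallel at p.   *)

(** The space of symmetric directions at each point is the line spanned by [X3]. For the upper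
    bound, [killing_derive_X3] says that the horizontal components of a Killing field are constant
    along the centre, while being parallel at p ([parallel_atP]) forces their [X3]-derivative at p
    to be half the horizontal part of K(p), turned by a right angle. That part therefore vanishes
    ([parallel_killing_vertical]). For the lower bound, a rotation at half the speed of the vertical
    translation compensates the covariant derivative of [X3] at the base point ([killing_screw],
    [parallel_screw]); [Ystar] is this field based at the origin. Two tools carry the computation:
    [metricE], which writes the metric as dx^2 + dy^2 + [alpha]^2, and [act_commutator], which rests
    on the symmetry of second derivatives ([derive_comm]). *)

Set Implicit Arguments.
Unset Strict Implicit.
Unset Printing Implicit Defensive.
Import Order.TTheory GRing.Theory Num.Theory.
Import numFieldNormedType.Exports.
Local Open Scope ring_scope.

(** * Symmetry of second directional derivatives *)

Section Schwarz.
Variables (R : realType) (V : normedModType R).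
Implicit Types (f : V -> R) (p u v : V).

Lemma is_derive_line f p u (t : R) : derivable f (t *: u + p) u ->
  is_derive t (1 : R) (fun s : R => f (s *: u + p)) ('D_u f (t *: u + p)).
Proof.
have E (h : R) : (h *: (1 : R) + t) *: u + p = h *: u + (t *: u + p).
  by rewrite scalerDl [h *: 1]mulr1 addrA.
move=> df; have eqf : (fun h : R => h^-1 *:
   (((fun s : R => f (s *: u + p)) \o shift t) (h *: (1 : R)) - f (t *: u + p)))
   = (fun h : R => h^-1 *: ((f \o shift (t *: u + p)) (h *: u) - f (t *: u + p))).
  by apply/funext => h /=; rewrite E.
by apply: DeriveDef; rewrite /derivable /derive /= eqf.
Qed.

Lemma MVT_line f p u (h : R) : 0 < h -> (forall q, derivable f q u) ->
  exists2 c, `|c| <= h & f (h *: u + p) - f p = 'D_u f (c *: u + p) * h.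
Proof.
move=> h0 df; have dline t := is_derive_line (df (t *: u + p)).
have [|c /[!in_itv]/= /andP[c0 ch]] := MVT h0 (fun t _ => dline t).
  apply: derivable_within_continuous => t _.
  by have [] := dline t.
rewrite scale0r add0r subr0 => ->; exists c => //.
by rewrite ger0_norm ltW.
Qed.

(** The mean value theorem is used twice: along [u] for the increment [F] of [f] over [h *: v], then
    along [v] for ['D_u f]. *)
Lemma second_difference f p u v (h : R) : 0 < h ->
  (forall q, derivable f q u) -> (forall q, derivable ('D_u f) q v) ->
  exists c d, [/\ `|c| <= h, `|d| <= h &
    f (h *: u + h *: v + p) - f (h *: u + p) - f (h *: v + p) + f p
    = 'D_v ('D_u f) (c *: u + d *: v + p) * h * h].
Proof.
move=> h0 df ddf.
pose F q := f (q + h *: v) - f q.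
have dsh q : is_derive q u (fun q => f (q + h *: v)) ('D_u f (q + h *: v)).
  have eqf : (fun k : R => k^-1 *:
     (((fun q => f (q + h *: v)) \o shift q) (k *: u) - f (q + h *: v)))
     = (fun k : R => k^-1 *: ((f \o shift (q + h *: v)) (k *: u) - f (q + h *: v))).
    by apply/funext => k /=; rewrite addrA.
  by apply: DeriveDef; rewrite /derivable /derive /= eqf //; exact: df.
have dF q : is_derive q u F ('D_u f (q + h *: v) - 'D_u f q).
  exact: (is_deriveB (dsh q) (derivableP (df q))).
have [c ch] := MVT_line p h0 (fun q => @ex_derive _ _ _ _ _ _ _ (dF q)).
rewrite derive_val => Fc.
have [d dh] := MVT_line (c *: u + p) h0 ddf.
rewrite [h *: v + _]addrC => Ed; exists c, d; split=> //.
rewrite [c *: u + d *: v]addrC -[d *: v + _ + p]addrA -Ed -Fc /F.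
by rewrite [h *: u + h *: v + p]addrAC [h *: v + p]addrC; ring.
Qed.

Lemma continuous_at_combination (F : V -> R) p u v (e : R) :
  {for p, continuous F} -> 0 < e ->
  exists2 h, 0 < h & forall c d, `|c| <= h -> `|d| <= h ->
    `|F p - F (c *: u + d *: v + p)| < e.
Proof.
move=> /cvgrPdist_lt/(_ e) + e0 => /(_ e0) /nbhs_ballP[r /= r0 Fr].
(* The summand 1 keeps [M] positive even when [u] and [v] both vanish. *)
pose M : R := `|u| + `|v| + 1.
have M0 : 0 < M by rewrite ltr_wpDl// addr_ge0.
exists (r / M / 2); first by rewrite !divr_gt0.
move=> c d ch dh; apply: Fr; rewrite -ball_normE /= opprD addrCA subrr addr0 normrN.
rewrite (le_lt_trans (ler_normD _ _))// !normrZ.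
have: r / M * M = r by rewrite divfK ?gt_eqF.
have rM0 : 0 < r / M by rewrite divr_gt0.
move: (r / M) rM0 ch dh => s s0 ch dh <-.
apply: (@le_lt_trans _ _ (s / 2 * `|u| + s / 2 * `|v|)).
  by rewrite lerD// ler_wpM2r.
rewrite -mulrDr -mulrA ltr_pM2l // /M.
by have := normr_ge0 u; have := normr_ge0 v; lra.
Qed.

(** The second difference is symmetric in [u] and [v], so the two mixed derivatives take a common
    value at two points that tend to [p] with [h]; continuity at [p] concludes. *)
Lemma derive_comm f p u v :
  (forall q, derivable f q u) -> (forall q, derivable f q v) ->
  (forall q, derivable ('D_u f) q v) -> (forall q, derivable ('D_v f) q u) ->
  {for p, continuous ('D_v ('D_u f))} -> {for p, continuous ('D_u ('D_v f))} ->
  'D_v ('D_u f) p = 'D_u ('D_v f) p.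
Proof.
move=> dfu dfv dfuv dfvu cuv cvu; apply/eqP; rewrite -subr_eq0 -normr_le0.
apply/ler_addgt0Pr => e e0; rewrite add0r.
have e20 : 0 < e / 2 by rewrite divr_gt0.
have [h1 h10 H1] := continuous_at_combination u v cuv e20.
have [h2 h20 H2] := continuous_at_combination v u cvu e20.
pose h := Num.min h1 h2.
have h0 : 0 < h by rewrite lt_min h10.
have [c [d [ch dh E]]] := second_difference p h0 dfu dfuv.
have [c' [d' [ch' dh' E']]] := second_difference p h0 dfv dfvu.
have := H1 c d; have := H2 c' d'.
have hh1 : h <= h1 by rewrite ge_min lexx.
have hh2 : h <= h2 by rewrite ge_min lexx orbT.
move=> /(_ (le_trans ch' hh2) (le_trans dh' hh2)) B2.
move=> /(_ (le_trans ch hh1) (le_trans dh hh1)) B1.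
(* Both sides times [h * h] equal the same second difference. *)
have {E E'} EE : 'D_v ('D_u f) (c *: u + d *: v + p)
    = 'D_u ('D_v f) (c' *: v + d' *: u + p).
  apply: (mulIf (lt0r_neq0 h0)); apply: (mulIf (lt0r_neq0 h0)).
  apply: etrans (esym E) (etrans _ E').
  by rewrite [h *: v + h *: u]addrC; congr (_ + _); exact: addrAC.
rewrite EE in B1.
move: ('D_u ('D_v f) (c' *: v + d' *: u + p)) B1 B2 => x B1 B2.
apply: le_trans (ler_distD x _ _) _; rewrite [X in _ + X]distrC [e]splitr.
exact: ltW (ltrD B1 B2).
Qed.

End Schwarz.


(** * Calculus of smooth functions and vector fields *)

Section Smooth.
Variables (R : realType) (n : nat).
Implicit Types (f h : scalar_field R n) (p u v : 'rV[R]_n) (X Y : vector_field R n).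

Lemma smooth_differentiable f p : smooth f -> differentiable f p.
Proof. by move=> /(_ 1)[]. Qed.

Lemma smooth_derivable f p v : smooth f -> derivable f p v.
Proof. by move=> sf; apply/diff_derivable/smooth_differentiable. Qed.

Lemma smooth_derive f v : smooth f -> smooth (fun p => 'D_v f p).
Proof. by move=> sf k; have [_] := sf k.+1; exact. Qed.

Lemma smoothP f : (forall p, differentiable f p) ->
  (forall v, smooth (fun p => 'D_v f p)) -> smooth f.
Proof. by move=> df sf [|k] //=; split=> // v; exact: sf. Qed.

Lemma derive_fctD f h p v : smooth f -> smooth h ->
  'D_v (fun q => f q + h q) p = 'D_v f p + 'D_v h p.
Proof.
by move=> sf sh; exact: deriveD (smooth_derivable sf) (smooth_derivable sh).
Qed.

Lemma derive_fctM f h p v : smooth f -> smooth h ->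
  'D_v (fun q => f q * h q) p = f p * 'D_v h p + h p * 'D_v f p.
Proof.
by move=> sf sh; exact: deriveM (smooth_derivable sf) (smooth_derivable sh).
Qed.

Lemma derive_fctN f p v : smooth f -> 'D_v (fun q => - f q) p = - 'D_v f p.
Proof. by move=> sf; exact: deriveN (smooth_derivable sf). Qed.

Lemma derive_fct_cst (c : R) p v : 'D_v (fun _ : 'rV[R]_n => c) p = 0.
Proof. exact: derive_cst. Qed.

Lemma derive_coord j p v : 'D_v (fun q : 'rV[R]_n => q 0 j) p = v 0 j.
Proof.
have := @derive_mx R 'rV[R]_n 1 n id p v (@derivable_id _ _ _ _).
by rewrite derive_id => /rowP/(_ j); rewrite mxE.
Qed.

Lemma smooth_cst (c : R) : smooth (fun _ : 'rV[R]_n => c).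
Proof.
move=> k; elim: k c => [|k IH] c //=; split=> [p|v].
  exact: differentiable_cst.
by under eq_fun do rewrite derive_fct_cst; exact: IH.
Qed.

Lemma smooth_coord j : smooth (fun p : 'rV[R]_n => p 0 j).
Proof.
apply: smoothP => [p|v]; first exact: differentiable_coord.
by under eq_fun do rewrite derive_coord; exact: smooth_cst.
Qed.

Lemma times_differentiableS k f :
  times_differentiable k.+1 f -> times_differentiable k f.
Proof.
elim: k f => [|k IH] f //= [df ddf]; split=> // v.
by apply: IH; exact: ddf.
Qed.

Lemma times_differentiableD k f h :
  times_differentiable k f -> times_differentiable k h ->
  times_differentiable k (fun p => f p + h p).
Proof.
elim: k f h => [|k IH] f h //= [df ddf] [dh ddh]; split=> [p|v].
  exact: differentiableD.
have -> : (fun p => 'D_v (fun p0 => f p0 + h p0) p)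
    = (fun p => 'D_v f p + 'D_v h p).
  apply/funext => p.
  exact: deriveD (diff_derivable (df p)) (diff_derivable (dh p)).
exact: IH.
Qed.

Lemma times_differentiableM k f h :
  times_differentiable k f -> times_differentiable k h ->
  times_differentiable k (fun p => f p * h p).
Proof.
elim: k f h => [|k IH] f h // sf sh.
have [df ddf] := sf; have [dh ddh] := sh; split=> [p|v].
  exact: differentiableM.
have -> : (fun p => 'D_v (fun p0 => f p0 * h p0) p)
    = (fun p => f p * 'D_v h p + h p * 'D_v f p).
  apply/funext => p.
  exact: deriveM (diff_derivable (df p)) (diff_derivable (dh p)).
(* The undifferentiated factors are known at order k + 1 and are lowered to order k. *)
by apply: times_differentiableD; apply: IH; solve
  [exact: ddf | exact: ddh | exact: times_differentiableS].
Qed.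

Lemma smoothD f h : smooth f -> smooth h -> smooth (fun p => f p + h p).
Proof. by move=> sf sh k; exact: times_differentiableD. Qed.

Lemma smoothM f h : smooth f -> smooth h -> smooth (fun p => f p * h p).
Proof. by move=> sf sh k; exact: times_differentiableM. Qed.

Lemma smoothN f : smooth f -> smooth (fun p => - f p).
Proof.
move=> sf; under eq_fun do rewrite -mulN1r.
by apply: smoothM => //; exact: smooth_cst.
Qed.

Lemma smooth_sum (I : Type) (r : seq I) (F : I -> scalar_field R n) :
  (forall i, smooth (F i)) -> smooth (fun p => \sum_(i <- r) F i p).
Proof.
move=> sF; elim: r => [|i r IH].
  by under eq_fun do rewrite big_nil; exact: smooth_cst.
by under eq_fun do rewrite big_cons; exact: smoothD.
Qed.

Lemma derive_fct_sum (I : Type) (r : seq I) (F : I -> scalar_field R n) p v :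
  (forall i, smooth (F i)) ->
  'D_v (fun q => \sum_(i <- r) F i q) p = \sum_(i <- r) 'D_v (F i) p.
Proof.
move=> sF; elim: r => [|i r IH].
  by under eq_fun do rewrite big_nil; rewrite derive_fct_cst big_nil.
under eq_fun do rewrite big_cons.
by rewrite big_cons -IH derive_fctD //; exact: smooth_sum.
Qed.

(** Fixes the directions of differentiation, so that a derivative along a varying field becomes a
    finite sum of products of smooth functions. *)
Lemma derive_basis f p v : smooth f ->
  'D_v f p = \sum_j v 0 j * 'D_(delta_mx 0 j) f p.
Proof.
move=> sf; rewrite deriveE; last exact: smooth_differentiable.
rewrite [in LHS](row_sum_delta v) linear_sum; apply: eq_bigr => j _.
by rewrite linearZ deriveE //; exact: smooth_differentiable.
Qed.

Lemma smooth_act X f : smooth_field X -> smooth f -> smooth (act X f).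
Proof.
move=> sX sf; rewrite /act; under eq_fun do rewrite derive_basis //.
by apply: smooth_sum => j; apply: smoothM; [exact: sX | exact: smooth_derive].
Qed.

Lemma derive_field X p v j : smooth_field X ->
  ('D_v X p) 0 j = 'D_v (fun q => X q 0 j) p.
Proof.
move=> sX; rewrite derive_mx ?mxE //.
by apply/derivable_mxP => i k; rewrite ord1; exact: smooth_derivable.
Qed.

Lemma smooth_derive_comm f p u v : smooth f ->
  'D_v ('D_u f) p = 'D_u ('D_v f) p.
Proof.
move=> sf; apply: derive_comm => *;
  try (apply: smooth_derivable => //; exact: smooth_derive);
  apply: differentiable_continuous; apply: smooth_differentiable;
  exact/smooth_derive/smooth_derive.
Qed.

(** Product rule: one term differentiates the direction [X], the other freezes it at [X p]. *)
Lemma derive_act X f p v : smooth_field X -> smooth f ->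
  'D_v (act X f) p = 'D_('D_v X p) f p + 'D_v ('D_(X p) f) p.
Proof.
move=> sX sf.
have -> : 'D_(X p) f = (fun q => \sum_j X p 0 j * 'D_(delta_mx 0 j) f q).
  by apply/funext => q; exact: derive_basis.
have -> : act X f = (fun q => \sum_j X q 0 j * 'D_(delta_mx 0 j) f q).
  by apply/funext => q; exact: derive_basis.
have sc j : smooth (fun q => X p 0 j * 'D_(delta_mx 0 j) f q).
  by apply: smoothM; [exact: smooth_cst | exact: smooth_derive].
have sv j : smooth (fun q => X q 0 j * 'D_(delta_mx 0 j) f q).
  by apply: smoothM; [exact: sX | exact: smooth_derive].
rewrite !derive_fct_sum // (derive_basis p ('D_v X p)) // -big_split.
apply: eq_bigr => j _; rewrite /= derive_field //.
rewrite !derive_fctM //;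
  try by [exact: smooth_cst | exact: smooth_derive | exact: sX].
by rewrite derive_fct_cst mulr0 addr0 addrC; congr (_ + _); exact: mulrC.
Qed.

Lemma derive_directionB f p u v : smooth f ->
  'D_(u - v) f p = 'D_u f p - 'D_v f p.
Proof.
by move=> sf; rewrite !deriveE ?linearB //; exact: smooth_differentiable.
Qed.

(** By [derive_act], the second-order terms have frozen directions, so they cancel by symmetry; only
    the derivatives of the directions remain. *)
Lemma act_commutator X Y f p : smooth_field X -> smooth_field Y -> smooth f ->
  act X (act Y f) p - act Y (act X f) p = act (lie_bracket X Y) f p.
Proof.
move=> sX sY sf; have E1 := derive_act p (X p) sY sf.
have E2 := derive_act p (Y p) sX sf.
have E3 := smooth_derive_comm p (X p) (Y p) sf.
rewrite E3 in E2; apply: etrans (congr2 (fun a b => a - b) E1 E2) _.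
have cancel_common (a b c : R) : a + c - (b + c) = a - b by ring.
apply: etrans (cancel_common _ _ _) _.
exact/esym/derive_directionB.
Qed.

End Smooth.


Ltac prove_smooth := by repeat first
  [ assumption | exact: smooth_coord | exact: smooth_cst
  | apply: smoothD | apply: smoothN | apply: smoothM ].

(** * Coordinates in dimension three *)

Section Vec3.
Variable R : realType.
Implicit Types (a b c : R) (f h k : scalar_field R 3).

Lemma vec3_0 a b c : vec3 a b c 0 0 = a. Proof. by rewrite mxE. Qed.
Lemma vec3_1 a b c : vec3 a b c 0 1 = b. Proof. by rewrite mxE. Qed.
Lemma vec3_2 a b c : vec3 a b c 0 2 = c. Proof. by rewrite mxE. Qed.
Definition vec3E := (vec3_0, vec3_1, vec3_2).

Lemma forall_ord3 (P : 'I_3 -> Prop) : P 0 -> P 1 -> P 2 -> forall j, P j.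
Proof.
move=> P0 P1 P2 [[|[|[|//]]] j3].
- by rewrite (_ : Ordinal j3 = 0) //; exact: val_inj.
- by rewrite (_ : Ordinal j3 = 1) //; exact: val_inj.
- by rewrite (_ : Ordinal j3 = 2) //; exact: val_inj.
Qed.

Lemma eq_row3 (u v : 'rV[R]_3) :
  u 0 0 = v 0 0 -> u 0 1 = v 0 1 -> u 0 2 = v 0 2 -> u = v.
Proof. by move=> e0 e1 e2; apply/rowP; exact: forall_ord3. Qed.

Lemma smooth_vec3 f h k : smooth f -> smooth h -> smooth k ->
  smooth_field (fun p => vec3 (f p) (h p) (k p)).
Proof.
move=> sf sh sk; apply: forall_ord3; under eq_fun do rewrite vec3E; done.
Qed.

Lemma derive_vec3 f h k p v : smooth f -> smooth h -> smooth k ->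
  'D_v (fun q => vec3 (f q) (h q) (k q)) p
  = vec3 ('D_v f p) ('D_v h p) ('D_v k p).
Proof.
move=> sf sh sk; apply: eq_row3; rewrite derive_field ?vec3E;
  try exact: smooth_vec3; by under eq_fun do rewrite vec3E.
Qed.

End Vec3.

(** * The left-invariant frame and its brackets *)

Section Frame.
Variable R : realType.
Implicit Types (p u v w : 'rV[R]_3).

Lemma smooth_X1 : smooth_field (@X1 R).
Proof. by apply: smooth_vec3; prove_smooth. Qed.

Lemma smooth_X2 : smooth_field (@X2 R).
Proof. by apply: smooth_vec3; prove_smooth. Qed.

Lemma smooth_X3 : smooth_field (@X3 R).
Proof. by apply: smooth_vec3; prove_smooth. Qed.

Lemma derive_X1 p v : 'D_v (@X1 R) p = vec3 0 0 (- (v 0 1 / 2)).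
Proof.
rewrite derive_vec3; try prove_smooth.
rewrite derive_fctN ?derive_fctM; try prove_smooth.
by rewrite derive_coord !derive_fct_cst mulr0 add0r mulrC.
Qed.

Lemma derive_X2 p v : 'D_v (@X2 R) p = vec3 0 0 (v 0 0 / 2).
Proof.
rewrite derive_vec3; try prove_smooth.
rewrite derive_fctM; try prove_smooth.
by rewrite derive_coord !derive_fct_cst mulr0 add0r mulrC.
Qed.

Lemma derive_X3 p v : 'D_v (@X3 R) p = 0.
Proof. exact: derive_cst. Qed.

Lemma bracket_X1_X2 : lie_bracket (@X1 R) (@X2 R) = @X3 R.
Proof.
apply/funext => p; rewrite /lie_bracket derive_X1 derive_X2.
by apply: eq_row3; rewrite !mxE /= ?mxE /=; field.
Qed.

Lemma bracket_X1_X3 : lie_bracket (@X1 R) (@X3 R) = fun=> 0.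
Proof.
apply/funext => p; rewrite /lie_bracket derive_X1 derive_X3.
by apply: eq_row3; rewrite !mxE /= ?mxE /=; field.
Qed.

Lemma bracket_X2_X3 : lie_bracket (@X2 R) (@X3 R) = fun=> 0.
Proof.
apply/funext => p; rewrite /lie_bracket derive_X2 derive_X3.
by apply: eq_row3; rewrite !mxE /= ?mxE /=; field.
Qed.

End Frame.


(** * The Killing equation as a linear system in frame components *)

Section KillingSystem.
Variable R : realType.
Implicit Types (f h a b c : scalar_field R 3) (X : vector_field R 3).

Lemma act_fctN X f p : smooth f -> act X (fun q => - f q) p = - act X f p.
Proof. exact: derive_fctN. Qed.

Lemma act_fctD X f h p : smooth f -> smooth h ->
  act X (fun q => f q + h q) p = act X f p + act X h p.
Proof. exact: derive_fctD. Qed.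

Lemma act_cst X (c : R) p : act X (fun=> c) p = 0.
Proof. exact: derive_fct_cst. Qed.

Lemma act_X1_X2 f p : smooth f ->
  act (@X1 R) (act (@X2 R) f) p = act (@X2 R) (act (@X1 R) f) p + act (@X3 R) f p.
Proof.
move=> sf; apply/eqP; rewrite addrC -subr_eq; apply/eqP.
by rewrite -bracket_X1_X2; apply: act_commutator => //;
  [exact: smooth_X1 | exact: smooth_X2].
Qed.

Lemma act_0 f p : smooth f -> act (fun=> 0) f p = 0.
Proof.
move=> sf; rewrite /act deriveE; last exact: smooth_differentiable.
exact: linear0.
Qed.

Lemma act_X1_X3 f : smooth f ->
  act (@X1 R) (act (@X3 R) f) = act (@X3 R) (act (@X1 R) f).
Proof.
move=> sf; apply/funext => p; apply/eqP; rewrite -subr_eq0; apply/eqP.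
rewrite -[RHS](act_0 p sf) -bracket_X1_X3.
by apply: act_commutator => //; [exact: smooth_X1 | exact: smooth_X3].
Qed.

Lemma act_X2_X3 f : smooth f ->
  act (@X2 R) (act (@X3 R) f) = act (@X3 R) (act (@X2 R) f).
Proof.
move=> sf; apply/funext => p; apply/eqP; rewrite -subr_eq0; apply/eqP.
rewrite -[RHS](act_0 p sf) -bracket_X2_X3.
by apply: act_commutator => //; [exact: smooth_X2 | exact: smooth_X3].
Qed.

(** Here [a], [b], [c] stand for the components of a Killing field along [X1], [X2], [X3]. Commuting
    derivatives on [a], [b], [c], and then on the rotation rate [A], gives enough relations to kill
    both [X3]-derivatives. *)
Lemma killing_system_derive_X3 a b c :
  smooth a -> smooth b -> smooth c ->
  act (@X1 R) a = (fun=> 0) -> act (@X2 R) b = (fun=> 0) ->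
  act (@X3 R) c = (fun=> 0) ->
  act (@X1 R) b = (fun p => - act (@X2 R) a p) ->
  act (@X1 R) c = (fun p => - (b p + act (@X3 R) a p)) ->
  act (@X2 R) c = (fun p => a p + - act (@X3 R) b p) ->
  forall p, act (@X3 R) a p = 0 /\ act (@X3 R) b p = 0.
Proof.
move=> sa sb sc a1 b2 c3 b1 c1 c2.
have sX1 := @smooth_X1 R; have sX2 := @smooth_X2 R; have sX3 := @smooth_X3 R.
have sE1 f : smooth f -> smooth (act (@X1 R) f) by exact: smooth_act.
have sE2 f : smooth f -> smooth (act (@X2 R) f) by exact: smooth_act.
have sE3 f : smooth f -> smooth (act (@X3 R) f) by exact: smooth_act.
have com12 := act_X1_X2; have com13 := act_X1_X3; have com23 := act_X2_X3.
have ED X := act_fctD X; have EN X := act_fctN X; have E0 X := act_cst X 0.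
have a2 : act (@X2 R) a = (fun p => - act (@X1 R) b p).
  by rewrite b1; apply/funext => p; rewrite opprK.
(* The frame derivatives become abstract operators: only additivity, smoothness and the commutation
   relations matter from here on. *)
move: (act (@X1 R)) (act (@X2 R)) (act (@X3 R)) (ED (@X1 R)) (ED (@X2 R))
  (ED (@X3 R)) (EN (@X1 R)) (EN (@X2 R)) (EN (@X3 R)) (E0 (@X1 R)) (E0 (@X2 R))
  (E0 (@X3 R)) a1 b2 c3 b1 c1 c2 a2 sE1 sE2 sE3 com12 com13 com23 => E1 E2 E3.
move=> {ED EN E0} E1D E2D E3D E1N E2N E3N E10 E20 E30 a1 b2 c3 b1 c1 c2 a2.
move=> sE1 sE2 sE3 com12 com13 com23.
pose A := E1 b.
have E1A p : E1 A p = - E3 a p.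
  have := com12 _ p sa; rewrite a2 a1 E20 E1N ?add0r; last exact: sE1.
  by move/eqP; rewrite eqr_oppLR => /eqP.
have E2A p : E2 A p = - E3 b p.
  have := com12 _ p sb; rewrite b2 E10 => /esym/eqP.
  by rewrite addr_eq0 => /eqP.
have E3E3a p : E3 (E3 a) p = - E3 b p.
  have /(congr1 (@^~ p)) := com13 _ sc; rewrite c3 E10 c1.
  rewrite E3N ?E3D; try by [| exact: sE3 | apply: smoothD => //; exact: sE3].
  by move=> /esym/eqP; rewrite oppr_eq0 addrC addr_eq0 => /eqP.
have E3E3b p : E3 (E3 b) p = E3 a p.
  have /(congr1 (@^~ p)) := com23 _ sc; rewrite c3 E20 c2.
  rewrite E3D ?E3N; try by [| exact: sE3 | apply: smoothN; exact: sE3].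
  by move=> /esym/eqP; rewrite subr_eq0 => /eqP.
(* Commuting [E1] and [E2] on [c] gives - [E3 A] = [E3 A]. *)
have E3A : E3 A = fun=> 0.
  apply/funext => p; have := com12 _ p sc; rewrite c1 c2 c3 addr0.
  rewrite E1D ?E1N; try by [| exact: sE3 | apply: smoothN; exact: sE3].
  rewrite a1 add0r E2N; last by apply: smoothD => //; exact: sE3.
  rewrite E2D ?b2 ?add0r; try by [| exact: sE3].
  rewrite com13 // com23 // a2 E3N; last exact: sE1.
  by rewrite -/A; move: (E3 A p) => x; lra.
have sA : smooth A by exact: sE1.
have wa : E1 A = (fun q => - E3 a q) by apply/funext.
have wb : E2 A = (fun q => - E3 b q) by apply/funext.
(* Since [E3 A] = 0, [E3] also kills [E1 A] = - [E3 a] and [E2 A] = - [E3 b]. The second derivatives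
   [E3 (E3 a)] and [E3 (E3 b)] thus vanish, and they equal - [E3 b] and [E3 a]. *)
move=> p; split.
  have /(congr1 (@^~ p)) := com23 _ sA; rewrite E3A E20 wb E3N; last exact: sE3.
  by rewrite E3E3b => /esym/eqP; rewrite oppr_eq0 => /eqP.
have /(congr1 (@^~ p)) := com13 _ sA; rewrite E3A E10 wa E3N; last exact: sE3.
by rewrite E3E3a opprK.
Qed.

End KillingSystem.


(** * The contact form of the Heisenberg group *)

Section ContactForm.
Variable R : realType.
Implicit Types (p u v w : 'rV[R]_3) (X Y : vector_field R 3).

(* [alpha p] is the 1-form dz + (y/2) dx - (x/2) dy dual to X3, and its        *)
(* derivative along v is [omega v].                                            *)
Definition alpha p u : R := u 0 2 + p 0 1 / 2 * u 0 0 - p 0 0 / 2 * u 0 1.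

Definition omega v u : R := (v 0 1 * u 0 0 - v 0 0 * u 0 1) / 2.

Lemma smooth_alpha Y : smooth_field Y -> smooth (fun q => alpha q (Y q)).
Proof.
move=> sY; have s0 := sY 0; have s1 := sY 1; have s2 := sY 2.
by rewrite /alpha; prove_smooth.
Qed.

Lemma derive_alpha Y p v : smooth_field Y ->
  'D_v (fun q => alpha q (Y q)) p = alpha p ('D_v Y p) + omega v (Y p).
Proof.
move=> sY; have s0 := sY 0; have s1 := sY 1; have s2 := sY 2.
rewrite /alpha !derive_field //.
rewrite !(derive_fctD, derive_fctN, derive_fctM); try prove_smooth.
rewrite !derive_coord !derive_fct_cst /omega /GRing.scale /=.
move: ('D_v _ p) ('D_v _ p) ('D_v _ p) => d2 d0 d1.
by field.
Qed.

End ContactForm.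

(** * The Heisenberg metric, its Killing fields and their covariant derivatives *)

Section HeisenbergMetric.
Variables (R : realType) (g : metric_field R 3).
Hypotheses (g_riemannian : riemannian_metric g)
           (g_orthonormal : orthonormal_frame g (@heis_frame R)).
Implicit Types (p u v w : 'rV[R]_3) (K X Y Z : vector_field R 3).

Lemma metricDl p u u' v : g p (u + u') v = g p u v + g p u' v.
Proof. by rewrite -[u]scale1r (metric_linear g_riemannian) !(scale1r, mul1r). Qed.

Lemma metric0l p v : g p 0 v = 0.
Proof. by apply: (addIr (g p 0 v)); rewrite -metricDl !add0r. Qed.

Lemma metricZl p c u v : g p (c *: u) v = c * g p u v.
Proof. by rewrite -[c *: u]addr0 (metric_linear g_riemannian) metric0l addr0. Qed.

(** The frame coefficients of a tangent vector are its first two coordinates and its value under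
    [alpha], and the frame is orthonormal. *)
Lemma metricE p u v :
  g p u v = u 0 0 * v 0 0 + u 0 1 * v 0 1 + alpha p u * alpha p v.
Proof.
have gsym := Defs.metric_sym g_riemannian p.
have decomp w : w = w 0 0 *: X1 p + w 0 1 *: X2 p + alpha p w *: X3 p.
  by apply: eq_row3; rewrite !mxE /= ?mxE /= /alpha; field.
have E i j : g p (heis_frame i p) (heis_frame j p) = (i == j)%:R.
  exact: g_orthonormal.
have E00 := E 0 0; have E01 := E 0 1; have E02 := E 0 2.
have E10 := E 1 0; have E11 := E 1 1; have E12 := E 1 2.
have E20 := E 2 0; have E21 := E 2 1; have E22 := E 2 2.
rewrite /heis_frame /= in E00 E01 E02 E10 E11 E12 E20 E21 E22.
have gDr a b c : g p a (b + c) = g p a b + g p a c.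
  by rewrite gsym metricDl !(gsym _ a).
have gZr k a b : g p a (k *: b) = k * g p a b by rewrite gsym metricZl gsym.
rewrite {1}(decomp u) {1}(decomp v) !(metricDl, metricZl, gDr, gZr).
rewrite E00 E01 E02 E10 E11 E12 E20 E21 E22.
by rewrite !(mulr0, mulr1, addr0, add0r).
Qed.

Lemma derive_inner Y Z p v : smooth_field Y -> smooth_field Z ->
  'D_v (inner g Y Z) p = g p ('D_v Y p) (Z p) + g p (Y p) ('D_v Z p)
    + omega v (Y p) * alpha p (Z p) + omega v (Z p) * alpha p (Y p).
Proof.
move=> sY sZ; rewrite /inner; under eq_fun do rewrite metricE.
have [sY0 sY1 sZ0 sZ1] := And4 (sY 0) (sY 1) (sZ 0) (sZ 1).
have saY := smooth_alpha sY; have saZ := smooth_alpha sZ.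
rewrite 2?derive_fctD ?derive_fctM; try prove_smooth.
rewrite !derive_alpha // -!derive_field // !metricE.
move: ('D_v Y p) ('D_v Z p) => dY dZ; ring.
Qed.

Lemma metricBl p u u' v : g p (u - u') v = g p u v - g p u' v.
Proof. by rewrite metricDl -scaleN1r metricZl mulN1r. Qed.

Lemma metricBr p u v v' : g p u (v - v') = g p u v - g p u v'.
Proof. by rewrite !(Defs.metric_sym g_riemannian _ u) metricBl. Qed.

(** The derivatives of [Y] and [Z] cancel against the brackets. What is left depends only on their
    values at [p], so the Killing equation can be tested on constant fields. *)
Lemma lie_derivativeE K Y Z p :
  smooth_field K -> smooth_field Y -> smooth_field Z ->
  lie_derivative_metric g K Y Z p
  = g p ('D_(Y p) K p) (Z p) + g p (Y p) ('D_(Z p) K p)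
    + omega (K p) (Y p) * alpha p (Z p) + omega (K p) (Z p) * alpha p (Y p).
Proof.
move=> sK sY sZ; rewrite /lie_derivative_metric /act derive_inner //.
rewrite /inner /lie_bracket metricBl metricBr.
move: ('D_(K p) Y p) ('D_(K p) Z p) ('D_(Y p) K p) ('D_(Z p) K p) => *; ring.
Qed.

Lemma smooth_field_cst (u : 'rV[R]_3) : smooth_field (fun _ : 'rV[R]_3 => u).
Proof. by move=> j; exact: smooth_cst. Qed.

Lemma killingP K : killing g K <-> smooth_field K /\ forall p u w,
  g p ('D_u K p) w + g p u ('D_w K p)
    + omega (K p) u * alpha p w + omega (K p) w * alpha p u = 0.
Proof.
split=> [[sK LK]|[sK eqK]]; split=> //.
  move=> p u w; have su := smooth_field_cst u; have sw := smooth_field_cst w.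
  by have := LK _ _ su sw p; rewrite lie_derivativeE.
by move=> Y Z sY sZ p; rewrite lie_derivativeE.
Qed.

(** This is the Koszul formula, simplified by the Killing equation for [Z] and [W]. *)
Lemma nabla_killing nabla K Z W p : levi_civita g nabla -> killing g K ->
  smooth_field Z -> smooth_field W ->
  g p (nabla Z K p) (W p) = g p ('D_(Z p) K p) (W p)
    + omega (K p) (W p) * alpha p (Z p) + omega (Z p) (W p) * alpha p (K p).
Proof.
move=> [_ torsion metric] kK sZ sW; have [sK eqK] := (killingP K).1 kK.
have tors Y Y' (sY : smooth_field Y) (sY' : smooth_field Y') v :
    g p (nabla Y Y' p) v = g p (nabla Y' Y p) v
      + g p ('D_(Y p) Y' p) v - g p ('D_(Y' p) Y p) v.
  have := torsion _ _ sY sY' p; rewrite /lie_bracket => /(canRL (subrK _)) ->.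
  by rewrite metricDl metricBl addrC addrA.
have mZ := metric _ _ _ sZ sK sW p.
have mW := metric _ _ _ sW sK sZ p.
have mK := metric _ _ _ sK sZ sW p.
rewrite /act !derive_inner // /inner in mZ mW mK.
have gC := Defs.metric_sym g_riemannian p.
have := eqK p (Z p) (W p); move: mZ mW mK.
(* Vanishing torsion leaves three unknown pairings, those of [nabla Z K] with [W], [nabla W K] with
   [Z] and [nabla W Z] with [K]. The three metric identities are linear in them. *)
rewrite (tors K Z) // (gC (Z p) (nabla K W p)) (tors K W) //.
rewrite (gC (K p) (nabla Z W p)) (tors Z W) // (gC (K p) (nabla W Z p)).
rewrite (gC (Z p) ('D_(W p) K p)) (gC (Z p) ('D_(K p) W p)).
rewrite (gC (K p) ('D_(W p) Z p)) (gC (K p) ('D_(Z p) W p)).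
have omegaC u v : omega u v = - omega v u by rewrite /omega; field.
rewrite (omegaC (Z p) (K p)) (omegaC (W p) (K p)) (omegaC (W p) (Z p)).
move: (nabla K Z p) (nabla K W p) (nabla W Z p) ('D_(Z p) K p) ('D_(W p) K p)
  ('D_(K p) Z p) ('D_(K p) W p) ('D_(Z p) W p) ('D_(W p) Z p) => *.
lra.
Qed.

Lemma parallel_atP nabla K p : levi_civita g nabla -> killing g K ->
  parallel_at nabla K p <-> forall u w,
    g p ('D_u K p) w + omega (K p) w * alpha p u + omega u w * alpha p (K p) = 0.
Proof.
move=> lc kK; split=> [parK u w|eqK Z sZ].
  have su := smooth_field_cst u; have sw := smooth_field_cst w.
  by have := nabla_killing p lc kK su sw; rewrite parK // metric0l.
(* The formula, applied to the constant field with value [nabla Z K p], makes the squared norm of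
   that vector zero. *)
apply/eqP/negPn/negP => /(metric_pos g_riemannian p).
have sN := smooth_field_cst (nabla Z K p).
by rewrite (nabla_killing p lc kK sZ sN) eqK ltxx.
Qed.

(** * Killing fields in the frame *)

Lemma alpha_X1 p : alpha p (X1 p) = 0.
Proof. by rewrite /alpha !vec3E; field. Qed.

Lemma alpha_X2 p : alpha p (X2 p) = 0.
Proof. by rewrite /alpha !vec3E; field. Qed.

Lemma alpha_X3 p : alpha p (X3 p) = 1.
Proof. by rewrite /alpha !vec3E; field. Qed.

Definition alphaE := (alpha_X1, alpha_X2, alpha_X3).

Lemma metric_X1 p u : g p u (X1 p) = u 0 0.
Proof. by rewrite metricE alpha_X1 !vec3E !(mulr0, mulr1, addr0). Qed.

Lemma metric_X2 p u : g p u (X2 p) = u 0 1.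
Proof. by rewrite metricE alpha_X2 !vec3E !(mulr0, mulr1, addr0, add0r). Qed.

Lemma metric_X3 p u : g p u (X3 p) = alpha p u.
Proof. by rewrite metricE alpha_X3 !vec3E !(mulr0, mulr1, addr0, add0r). Qed.

Definition metric_frameE := (metric_X1, metric_X2, metric_X3).

(** These are the six instances of [killingP] on unordered pairs of frame vectors. *)
Lemma killing_frame K p : killing g K ->
  [/\ 'D_(X1 p) K p 0 0 = 0, 'D_(X2 p) K p 0 1 = 0
    & alpha p ('D_(X3 p) K p) = 0] /\
  [/\ 'D_(X1 p) K p 0 1 = - 'D_(X2 p) K p 0 0,
      alpha p ('D_(X1 p) K p) = - (K p 0 1 / 2 + 'D_(X3 p) K p 0 0)
    & alpha p ('D_(X2 p) K p) = K p 0 0 / 2 - 'D_(X3 p) K p 0 1].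
Proof.
move=> /killingP[_ eqK]; have gC := Defs.metric_sym g_riemannian p.
have := eqK p (X1 p) (X1 p); have := eqK p (X2 p) (X2 p).
have := eqK p (X3 p) (X3 p); have := eqK p (X1 p) (X2 p).
have := eqK p (X1 p) (X3 p); have := eqK p (X2 p) (X3 p).
move: ('D_(X1 p) K p) ('D_(X2 p) K p) ('D_(X3 p) K p) => d1 d2 d3.
rewrite !(gC (X1 p) _) !(gC (X2 p) _) !(gC (X3 p) _) !metric_frameE !alphaE.
rewrite /omega !vec3E => *; do !split; lra.
Qed.

(** The frame components of [K] solve the linear system. Differentiating [alpha] itself adds an
    [omega] term, which turns the halves of [killing_frame] into the full [a] and [b] of the
    system. *)
Lemma killing_derive_X3 K : killing g K -> forall p,
  'D_(X3 p) K p 0 0 = 0 /\ 'D_(X3 p) K p 0 1 = 0.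
Proof.
move=> kK p; have [sK _] := kK.
have act_coord X q j : act X (fun q => K q 0 j) q = 'D_(X q) K q 0 j.
  by rewrite derive_field.
have act_alpha X q : act X (fun q => alpha q (K q)) q
    = alpha q ('D_(X q) K q) + omega (X q) (K q) by exact: derive_alpha.
have [] := killing_system_derive_X3 (sK 0) (sK 1) (smooth_alpha sK) _ _ _ _ _ _ p;
  last by rewrite !act_coord.
all: apply/funext => q; rewrite ?act_coord ?act_alpha.
all: have := killing_frame q kK.
all: move: ('D_(X1 q) K q) ('D_(X2 q) K q) ('D_(X3 q) K q) => d1 d2 d3.
all: case=> -[e1 e2 e3] [e4 e5 e6]; rewrite /omega ?vec3E; lra.
Qed.

(** Tested on ([X3], [X1]) and ([X3], [X2]), parallelism equates the [X3]-derivatives of the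
    horizontal components, which are zero, with - [K p 0 1 / 2] and [K p 0 0 / 2]. *)
Lemma parallel_killing_vertical nabla K p : levi_civita g nabla ->
  killing g K -> parallel_at nabla K p -> K p = K p 0 2 *: X3 p.
Proof.
move=> lc kK /(parallel_atP _ lc kK) eqK.
have [] := killing_derive_X3 kK p.
have := eqK (X3 p) (X1 p); have := eqK (X3 p) (X2 p).
rewrite !metric_frameE !alphaE.
move: ('D_(X3 p) K p) => d; rewrite /omega !vec3E => e2 e1 d0 d1.
by apply: eq_row3; rewrite !mxE /=; lra.
Qed.

(* [k] times the pushforward of X3 + X4* / 2 by the left translation by [p0]. *)
Definition screw (p0 : 'rV[R]_3) (k : R) : vector_field R 3 := fun q =>
  vec3 (- (k / 2) * (q 0 1 - p0 0 1)) (k / 2 * (q 0 0 - p0 0 0))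
    (k + k / 4 * (p0 0 1 * (q 0 1 - p0 0 1) + p0 0 0 * (q 0 0 - p0 0 0))).

Lemma smooth_screw p0 k : smooth_field (screw p0 k).
Proof. by apply: smooth_vec3; prove_smooth. Qed.

Lemma derive_screw p0 k p v : 'D_v (screw p0 k) p
  = vec3 (- (k / 2) * v 0 1) (k / 2 * v 0 0)
         (k / 4 * (p0 0 1 * v 0 1 + p0 0 0 * v 0 0)).
Proof.
rewrite derive_vec3; try prove_smooth.
rewrite !(derive_fctD, derive_fctM); try prove_smooth.
by rewrite !derive_coord !derive_fct_cst; apply: eq_row3; rewrite !vec3E; ring.
Qed.

Lemma killing_screw p0 k : killing g (screw p0 k).
Proof.
apply/killingP; split=> [|p u w]; first exact: smooth_screw.
by rewrite !derive_screw !metricE /alpha /omega !vec3E; field.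
Qed.

Lemma screw_base p0 k : screw p0 k p0 = vec3 0 0 k.
Proof. by apply: eq_row3; rewrite !vec3E; ring. Qed.

(** At [p0] the derivative of the field is horizontal, a rotation at rate [k / 2], and it cancels
    [omega u w] times the vertical component [k]. *)
Lemma parallel_screw nabla p0 k : levi_civita g nabla ->
  parallel_at nabla (screw p0 k) p0.
Proof.
move=> lc; apply/(parallel_atP _ lc (killing_screw p0 k)) => u w.
by rewrite derive_screw screw_base metricE /alpha /omega !vec3E; field.
Qed.

(** In coordinates [X4star] is the plain rotation field (-y, x, 0). *)
Lemma YstarE : @Ystar R = screw 0 1.
Proof.
by apply/funext => p; apply: eq_row3; rewrite !mxE /= ?mxE /=; field.
Qed.

End HeisenbergMetric.

Theorem theorem5p1 (R : realType) (g : metric_field R 3) (nabla : connection R 3)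
    (g_riemannian : riemannian_metric g)
    (g_left_invariant : left_invariant (@heis_mul R) g)
    (g_orthonormal : orthonormal_frame g (@heis_frame R))
    (nabla_levi_civita : levi_civita g nabla) :
  has_index_of_symmetry g nabla 1 /\
  killing g (@Ystar R) /\ parallel_at nabla (@Ystar R) 0.
Proof.
split; last first.
  rewrite YstarE; split; first exact: killing_screw.
  exact: (parallel_screw g_riemannian g_orthonormal).
move=> p; exists <[X3 p]>%VS; last first.
  rewrite dim_vline; suff -> : X3 p != 0 by [].
  by apply/eqP => /rowP/(_ 2); rewrite vec3E mxE => /eqP; rewrite oner_eq0.
apply/seteqP; split=> [v [K [kK <- parK]] | v /vlineP[k ->]] /=.
  rewrite (parallel_killing_vertical g_riemannian g_orthonormal _ kK parK) //.
  by rewrite memvZ ?memv_line.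
(* The parameter [k] scales the whole field, so every multiple of [X3 p] is reached. *)
exists (screw p k); split; [exact: killing_screw | |];
  last exact: (parallel_screw g_riemannian g_orthonormal).
by rewrite screw_base; apply: eq_row3; rewrite !mxE /=; ring.
Qed.
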